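(* Let $\mathcal{M}_i=\{\mathcal{H}_i,\Sigma,\rho_0^{(i)},\{\mathcal{E}_\sigma^{(i)}\}_{\sigma\in\Sigma\cup\{\triangleright,\$\}},\mathcal{H}_{acc}^{(i)},\mathcal{H}_{rej}^{(i)}\}$, $i=1,2$, be two MM-1gQFA on the same input alphabet $\Sigma$, and let $n_i=\dim\mathcal{H}_i$ for $i=1,2$. Then $\mathcal{M}_1$ and $\mathcal{M}_2$ are equivalent if and only if they are $(n_1+n_2)^2$-equivalent.
   Context: For a finite-dimensional complex Hilbert space $\mathcal{H}$, let $L(\mathcal{H})$ be the set of linear operators on $\mathcal{H}$. A density operator is a positive semidefinite operator of trace $1$; the support $\mathrm{supp}(A)$ of a positive operator $A$ is the span of its eigenvectors with nonzero eigenvalue. A trace-preserving quantum operation acting on $\mathcal{H}$ is a map $\mathcal{E}:L(\mathcal{H})\to L(\mathcal{H})$ of the form $\mathcal{E}(\rho)=\sum_k E_k\rho E_k^\dagger$ (finite sum) with $\sum_k E_k^\dagger E_k=I$. A measure-many one-way general quantum finite automaton (MM-1gQFA) is a tuple $\mathcal{M}=\{\mathcal{H},\Sigma,\rho_0,\{\mathcal{E}_\sigma\}_{\sigma\in\Sigma\cup\{\triangleright,\$\}},\mathcal{H}_{acc},\mathcal{H}_{rej}\}$ where $\mathcal{H}$ is a finite-dimensional Hilbert space, $\Sigma$ is a finite input alphabet, $\triangleright,\$\notin\Sigma$ are the left and right end-markers, each $\mathcal{E}_\sigma$ is a trace-preserving quantum operation acting on $\mathcal{H}$, $\mathcal{H}_{acc},\mathcal{H}_{rej}$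 are subspaces of $\mathcal{H}$ which together with another subspace $\mathcal{H}_{non}$ give an orthogonal decomposition $\mathcal{H}=\mathcal{H}_{acc}\oplus\mathcal{H}_{rej}\oplus\mathcal{H}_{non}$, and $\rho_0$ (the initial state) is a density operator on $\mathcal{H}$ with $\mathrm{supp}(\rho_0)\subseteq\mathcal{H}_{non}$. $P_{non},P_{acc},P_{rej}$ denote the orthogonal projectors onto $\mathcal{H}_{non},\mathcal{H}_{acc},\mathcal{H}_{rej}$. On input $x\in\Sigma^*$ the machine reads $\triangleright x\$$. Its total state is a triple $(\rho,p_{acc},p_{rej})\in L(\mathcal{H})\times\mathbb{R}\times\mathbb{R}$, starting at $(\rho_0,0,0)$, and reading a symbol $\sigma$ transforms it by $$(\rho,p_{acc},p_{rej})\mapsto\big(P_{non}\mathcal{E}_\sigma(\rho)P_{non},\ \mathrm{Tr}(P_{acc}\mathcal{E}_\sigma(\rho))+p_{acc},\ \mathrm{Tr}(P_{rej}\mathcal{E}_\sigma(\rho))+p_{rej}\big).$$ The accepting probability $f_{\mathcal{M}}(x)$ is the component $p_{acc}$ after all of $\triangleright x\$$ has been read. Two MM-1gQFA $\mathcal{M}_1,\mathcal{M}_2$ on the same input alphabet $\Sigma$ are equivalent if $f_{\mathcal{M}_1}(w)=f_{\mathcal{M}_2}(w)$ for all $w\in\Sigma^*$, and $k$-equivalent if $f_{\mathcal{M}_1}(w)=f_{\mathcal{M}_2}(w)$ for all $w\in\Sigma^*$ with length $|w|\le k$. *)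

(* Defs.v *)
From HB Require Import structures.
From mathcomp Require Import all_boot all_order all_algebra.
From mathcomp Require Import reals complex.

Set Implicit Arguments.
Unset Strict Implicit.
Unset Printing Implicit Defensive.

Import Order.TTheory GRing.Theory Num.Theory.
Local Open Scope ring_scope.
Local Open Scope complex_scope.
Local Open Scope sesquilinear_scope.

(* The n-dimensional Hilbert space is 'cV[R[i]]_n with inner product u^t* *m v,
   and 'M[R[i]]_n is the set of operators, acting on the left. *)

Section LinearOperators.
Variables (R : realType) (n : nat).
Local Notation C := R[i].
Implicit Types (A : 'M[C]_n) (U V : {vspace 'cV[C]_n}).

(* [0 <= z] in R[i] means that z is real and nonnegative, so that A is
   Hermitian. *)
Definition psd A : Prop := forall v : 'cV[C]_n, 0 <= (v^t* *m A *m v) 0 0.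

Definition density A : Prop := psd A /\ \tr A = 1.

Definition in_supp A (v : 'cV[C]_n) : Prop :=
  exists2 s : seq 'cV[C]_n,
    forall u, u \in s -> u != 0 /\ (exists2 a : C, a != 0 & A *m u = a *: u)
  & v \in <<s>>%VS.

Definition orthogonalv U V : Prop :=
  forall u v, u \in U -> v \in V -> u^t* *m v = 0.

(* [proj_ortho] acts on row vectors by right multiplication, whence the two
   transpositions; [orthoproj_mem] and [orthoproj_orthogonal] characterize the
   result. *)
Definition vspace_rows V : 'M[C]_(\dim V, n) :=
  \matrix_(i < \dim V) ((vbasis V)`_i)^T.

Definition orthoproj V : 'M[C]_n := (proj_ortho (vspace_rows V))^T.

Lemma vspace_rowsP V (v : 'cV[C]_n) : (v^T <= vspace_rows V)%MS = (v \in V).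
Proof.
apply/idP/idP => [/submxP[w /(congr1 trmx)]|/coord_vbasis->].
  rewrite trmxK trmx_mul => ->.
  have -> : (vspace_rows V)^T *m w^T = \sum_i w 0 i *: (vbasis V)`_i.
    apply/matrixP => i j; rewrite mxE summxE; apply: eq_bigr => k _.
    by rewrite !mxE mulrC ord1.
  apply: memv_suml => i _; apply: memvZ; apply: vbasis_mem.
  by apply: mem_nth; rewrite size_tuple.
rewrite raddf_sum; apply: summx_sub => i _.
rewrite /= linearZ; apply: scalemx_sub.
by rewrite -[X in (X <= _)%MS](rowK (fun i => ((vbasis V)`_i)^T) i) row_sub.
Qed.

Lemma orthoproj_mem V (v : 'cV[C]_n) : orthoproj V *m v \in V.
Proof. by rewrite -vspace_rowsP trmx_mul trmxK proj_ortho_sub. Qed.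

Lemma orthoproj_orthogonal V (u v : 'cV[C]_n) :
  u \in V -> u^t* *m (v - orthoproj V *m v) = 0.
Proof.
rewrite -vspace_rowsP => /submxP[w uE].
have /orthomx1P h := proj_ortho_compl_sub (vspace_rows V) v^T.
have {}h : (v - orthoproj V *m v)^T *m (vspace_rows V)^t* = 0.
  by rewrite linearB /= trmx_mul trmxK.
apply: trmx_inj; rewrite trmx_mul trmx0 uE map_mxM.
rewrite trmx_mul mulmxA (_ : (map_mx _ _)^T = (vspace_rows V)^t*) ?h ?mul0mx //.
by apply/matrixP => i j; rewrite !mxE.
Qed.

Definition tp_quantum_operation (E : 'M[C]_n -> 'M[C]_n) : Prop :=
  exists2 K : seq 'M[C]_n,
    forall rho, E rho = \sum_(A <- K) A *m rho *m A^t*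
  & \sum_(A <- K) A^t* *m A = 1%:M.

End LinearOperators.

Inductive tape_symbol (Sigma : Type) : Type :=
  | LeftMarker
  | RightMarker
  | Letter of Sigma.
Arguments LeftMarker {Sigma}.
Arguments RightMarker {Sigma}.

Record mm1gqfa (R : realType) (Sigma : finType) (n : nat) := MM1gQFA {
  init : 'M[R[i]]_n;
  op : tape_symbol Sigma -> 'M[R[i]]_n -> 'M[R[i]]_n;
  Hacc : {vspace 'cV[R[i]]_n};
  Hrej : {vspace 'cV[R[i]]_n};
  Hnon : {vspace 'cV[R[i]]_n};
  op_tp : forall s, tp_quantum_operation (op s);
  acc_rej_orthogonal : orthogonalv Hacc Hrej;
  acc_non_orthogonal : orthogonalv Hacc Hnon;
  rej_non_orthogonal : orthogonalv Hrej Hnon;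
  H_decomposition : (Hacc + Hrej + Hnon)%VS = fullv;
  init_density : density init;
  init_supp : forall v, in_supp init v -> v \in Hnon
}.

Section Semantics.
Variables (R : realType) (Sigma : finType) (n : nat) (M : mm1gqfa R Sigma n).

Definition total_state : Type := ('M[R[i]]_n * R * R)%type.

(* The traces are real numbers on the reachable states, which are positive
   semidefinite; [Re] only casts them from R[i] to R. *)
Definition step (st : total_state) (s : tape_symbol Sigma) : total_state :=
  let: (rho, pacc, prej) := st in
  let rho' := op M s rho in
  (orthoproj (Hnon M) *m rho' *m orthoproj (Hnon M),
   complex.Re (\tr (orthoproj (Hacc M) *m rho')) + pacc,
   complex.Re (\tr (orthoproj (Hrej M) *m rho')) + prej).

Definition tape (x : seq Sigma) : seq (tape_symbol Sigma) :=
  LeftMarker :: rcons (map (@Letter Sigma) x) RightMarker.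

Definition final_state (x : seq Sigma) : total_state :=
  foldl step (init M, 0, 0) (tape x).

Definition accept_prob (x : seq Sigma) : R :=
  let: (_, pacc, _) := final_state x in pacc.

End Semantics.

Section Equivalence.
Variables (R : realType) (Sigma : finType) (n1 n2 : nat).
Variables (M1 : mm1gqfa R Sigma n1) (M2 : mm1gqfa R Sigma n2).

Definition equivalent : Prop :=
  forall w : seq Sigma, accept_prob M1 w = accept_prob M2 w.

Definition k_equivalent (k : nat) : Prop :=
  forall w : seq Sigma, (size w <= k)%N -> accept_prob M1 w = accept_prob M2 w.

End Equivalence.

(* Main.v *)
Require Import Defs.
From HB Require Import structures.
From mathcomp Require Import all_boot all_order all_algebra.
From mathcomp Require Import reals complex.

Set Implicit Arguments.
Unset Strict Implicit.
Unset Printing Implicit Defensive.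

Import Order.TTheory GRing.Theory Num.Theory.
Local Open Scope ring_scope.
Local Open Scope complex_scope.
Local Open Scope sesquilinear_scope.

(* If the acceptance probability is accumulated as a complex number, which is
   legitimate because traces of positive operators are nonnegative, each machine
   becomes a linear automaton on M_n(C) x C, of dimension n^2 + 1. The spans of
   the pairs of states reached by words of length < k increase with k and become
   stationary once k reaches the total dimension, so two linear automata agree
   as soon as they agree on words shorter than n1^2 + n2^2 + 2, and
   n1^2 + n2^2 + 1 <= (n1 + n2)^2 for nonzero dimensions. *)

Section IteratedSpace.
Variables (K : fieldType) (V : vectType K).

(** Each step of the chain either changes nothing, and then nothing ever changes again, or raises
    the dimension by at least one. After [dim V] steps without a fixed point the whole space is
    reached, which an extensive [F] must fix. *)
Lemma iter_vspace_stable (F : {vspace V} -> {vspace V}) :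
  (forall U, (U <= F U)%VS) ->
  F (iter (dim V) F 0%VS) = iter (dim V) F 0%VS.
Proof.
move=> F_ext.
have grow k : F (iter k F 0%VS) = iter k F 0%VS
    \/ (k <= \dim (iter k F 0%VS))%N.
  elim: k => [|k [/= e|le_k]]; first by right.
    by left; rewrite /= !e.
  have [e|ne] := eqVneq (iter k F 0%VS) (F (iter k F 0%VS)).
    by left; rewrite /= -!e.
  right; apply: leq_ltn_trans le_k _.
  by rewrite ltn_neqAle (dimv_leqif_eq (F_ext _)) ne dimvS ?F_ext.
have [//|le_dim] := grow (dim V).
have full : iter (dim V) F 0%VS = fullv.
  by apply/eqP; rewrite eqEdim subvf dimvf.
by apply/eqP; rewrite full eqEsubv subvf F_ext.
Qed.

End IteratedSpace.

Section LinearAutomata.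
Variables (K : fieldType) (Sigma : finType).

Definition run (V : vectType K) (T : Sigma -> 'End(V)) (v : V)
    (w : seq Sigma) :=
  foldl (fun u s => T s u) v w.

Section OneAutomaton.
Variables (V : vectType K) (T : Sigma -> 'End(V)) (v0 : V).

(** The [k]-th iterate from 0 is the span of the states reached by words of length [< k]. The
    summand [U] makes the map extensive. *)
Definition extend_span (U : {vspace V}) : {vspace V} :=
  (<[v0]> + U + \sum_s (T s @: U))%VS.

Lemma iter_extend_span_sub (k : nat) (W : {vspace V}) :
  (forall w, (size w < k)%N -> run T v0 w \in W) ->
  (iter k extend_span 0%VS <= W)%VS.
Proof.
elim: k W => [|k IHk] W memW; first exact: sub0v.
rewrite /= /extend_span !subv_add -memvE; apply/andP; split.
  rewrite (memW [::]) //; apply: IHk => w lt_wk.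
  by apply: memW; apply: ltnW.
apply/subv_sumP => s _.
(* The induction hypothesis is used for the preimage of [W], since [s] is read last, after [w]. *)
have : (iter k extend_span 0%VS <= T s @^-1: W)%VS.
  apply: IHk => w lt_wk; rewrite -memv_preim.
  by have := memW (rcons w s); rewrite size_rcons ltnS /run foldl_rcons; apply.
move=> /subvP sub; apply/subvP => _ /memv_imgP[u /sub + ->].
by rewrite memv_preim.
Qed.

(** The stationary iterate contains [v0] and is closed under every [T s], so it contains all
    reachable states; short words already place it inside [W]. *)
Lemma run_mem_subspace (W : {vspace V}) :
  (forall w, (size w < dim V)%N -> run T v0 w \in W) ->
  forall w, run T v0 w \in W.
Proof.
move=> /iter_extend_span_sub/subvP subW w; apply: subW.
have : extend_span (iter (dim V) extend_span 0%VS)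
    = iter (dim V) extend_span 0%VS.
  apply: iter_vspace_stable => U.
  by rewrite /extend_span -addvA (subv_trans _ (addvSr _ _)) ?addvSl.
move: (iter _ _ _) => U fixU.
have memT s u : u \in U -> T s u \in U.
  move=> uU; rewrite -fixU (subvP (addvSr _ _)) //.
  by rewrite (subvP (sumv_sup s _ (subvv _))) // memv_img.
have : v0 \in U.
  by rewrite -fixU memvE /extend_span -addvA addvSl.
by rewrite /run; elim: w v0 => //= s w IHw v vU; apply: IHw; apply: memT.
Qed.

End OneAutomaton.

Variables (V1 V2 : vectType K).
Variables (T1 : Sigma -> 'End(V1)) (T2 : Sigma -> 'End(V2)).
Variables (v1 : V1) (v2 : V2).
Variables (f1 : {linear V1 -> K^o}) (f2 : {linear V2 -> K^o}).

(** Both automata run in parallel on [V1 * V2], and [W] is the kernel of the difference [d] of the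
    two output forms. *)
Lemma linear_automata_equiv :
  (forall w, (size w < dim V1 + dim V2)%N ->
     f1 (run T1 v1 w) = f2 (run T2 v2 w)) ->
  forall w, f1 (run T1 v1 w) = f2 (run T2 v2 w).
Proof.
move=> eq_short.
pose V := (V1 * V2)%type : vectType K.
pose T s (v : V) : V := (T1 s v.1, T2 s v.2).
have T_linear s : linear (T s).
  by move=> a [x1 x2] [y1 y2]; rewrite /T /= !linearP.
pose Tlin s : {linear V -> V} :=
  HB.pack (T s) (GRing.isLinear.Build K V V *:%R (T s) (T_linear s)).
pose d (v : V) : K^o := f1 v.1 - f2 v.2.
have d_linear : linear d.
  move=> a [x1 x2] [y1 y2]; rewrite /d /= !linearP /=.
  by rewrite addrACA scalerDr.
pose dlin : {linear V -> K^o} :=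
  HB.pack d (GRing.isLinear.Build K V K^o *:%R d d_linear).
have runE w : run (fun s => linfun (Tlin s)) ((v1, v2) : V) w
    = (run T1 v1 w, run T2 v2 w).
  rewrite /run; elim: w v1 v2 => //= s w IHw u1 u2.
  by rewrite (lfunE (Tlin s)) IHw.
have mem_ker w : (run (fun s => linfun (Tlin s)) ((v1, v2) : V) w
    \in lker (linfun dlin)) = (f1 (run T1 v1 w) == f2 (run T2 v2 w)).
  by rewrite memv_ker (lfunE dlin) runE /= subr_eq0.
move=> w; apply/eqP; rewrite -mem_ker.
apply: run_mem_subspace => {}w lt_w; rewrite mem_ker.
by apply/eqP/eq_short.
Qed.

End LinearAutomata.

Section PositiveOperators.
Variables (R : realType) (n : nat).
Local Notation C := R[i].
Implicit Types (A B : 'M[C]_n) (V : {vspace 'cV[C]_n}).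

Lemma adjmxM m p q (A : 'M[C]_(m, p)) (B : 'M[C]_(p, q)) :
  (A *m B)^t* = B^t* *m A^t*.
Proof. by rewrite trmx_mul map_mxM. Qed.

(** The range of [P] is orthogonal to that of [1 - P]; testing this on basis vectors gives each
    entry of [P^t* (1 - P) = 0]. *)
Lemma orthoproj_adjK V : (orthoproj V)^t* *m orthoproj V = (orthoproj V)^t*.
Proof.
set P := orthoproj V.
suff P_compl : P^t* *m (1%:M - P) = 0.
  by move/eqP: P_compl; rewrite mulmxBr mulmx1 subr_eq0 => /eqP.
apply/matrixP => i j.
have := orthoproj_orthogonal (delta_mx j 0)
  (orthoproj_mem V (delta_mx i 0 : 'cV_n)).
rewrite -/P adjmxM -[X in X - _]mul1mx -mulmxBl -mulmxA (mulmxA (P^t*)) -colE.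
move/matrixP/(_ 0 0).
have -> : (delta_mx i 0 : 'cV[C]_n)^t* = delta_mx 0 i.
  by rewrite trmx_delta map_delta_mx.
by rewrite -rowE !mxE.
Qed.

(** The adjoint of [P] equals [P^t* P], which is Hermitian. *)
Lemma orthoproj_adj V : (orthoproj V)^t* = orthoproj V.
Proof.
by rewrite -[RHS]trmxCK -[in RHS]orthoproj_adjK adjmxM trmxCK orthoproj_adjK.
Qed.

Lemma orthoproj_idem V : orthoproj V *m orthoproj V = orthoproj V.
Proof. by have := orthoproj_adjK V; rewrite orthoproj_adj. Qed.

Lemma psd_conj A B : psd B -> psd (A *m B *m A^t*).
Proof.
by move=> B_psd v; have := B_psd (A^t* *m v); rewrite adjmxM trmxCK !mulmxA.
Qed.

Lemma psd_tr A : psd A -> 0 <= \tr A.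
Proof.
move=> A_psd; apply: sumr_ge0 => i _.
have := A_psd (delta_mx i 0).
by rewrite trmx_delta map_delta_mx -rowE -colE !mxE.
Qed.

(** By idempotence and cyclicity, the trace of [P A] is that of [P A P^t*]. *)
Lemma psd_tr_orthoproj V A : psd A -> 0 <= \tr (orthoproj V *m A).
Proof.
move=> A_psd; rewrite -[orthoproj V]orthoproj_idem -mulmxA mxtrace_mulC.
by rewrite -{2}[orthoproj V]orthoproj_adj; apply/psd_tr/psd_conj.
Qed.

Lemma quantum_operation_linear (E : 'M[C]_n -> 'M[C]_n) :
  tp_quantum_operation E -> linear E.
Proof.
move=> [K EE _] a x y; rewrite !EE scaler_sumr -big_split.
by apply: eq_bigr => A _; rewrite mulmxDr mulmxDl -scalemxAr -scalemxAl.
Qed.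

Lemma quantum_operation_psd (E : 'M[C]_n -> 'M[C]_n) A :
  tp_quantum_operation E -> psd A -> psd (E A).
Proof.
move=> [K EE _] A_psd v; rewrite EE mulmx_sumr mulmx_suml summxE.
by apply: sumr_ge0 => B _; apply: psd_conj.
Qed.

Lemma density_dim_gt0 A : density A -> (0 < n)%N.
Proof.
move=> [_]; case: n A => // A.
by rewrite /mxtrace big_ord0 => /eqP; rewrite eq_sym oner_eq0.
Qed.

End PositiveOperators.

Section ComplexRun.
Variables (R : realType) (Sigma : finType) (n : nat) (M : mm1gqfa R Sigma n).
Local Notation C := R[i].
Local Notation state := ('M[C]_n * C^o)%type.

(* [step] with the acceptance probability accumulated in R[i] instead of being
   cast to R by [Re], which is not C-linear. *)
Definition cstep (s : tape_symbol Sigma) (st : state) : state :=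
  let rho := op M s st.1 in
  (orthoproj (Hnon M) *m rho *m orthoproj (Hnon M),
   \tr (orthoproj (Hacc M) *m rho) + st.2).

Lemma cstep_linear s : linear (cstep s).
Proof.
move=> a [x p] [y q]; rewrite /cstep /=.
rewrite (quantum_operation_linear (op_tp M s)) !mulmxDr mulmxDl.
rewrite -!scalemxAr -scalemxAl linearD linearZ /=.
by congr (_, _); rewrite /= scalerDr addrACA.
Qed.

HB.instance Definition _ s :=
  GRing.isLinear.Build C state state *:%R (cstep s) (cstep_linear s).

(** The right end-marker is absorbed into the output form, as the left one is into the initial
    vector, so that only letters act as transitions. *)
Definition caccept_form (st : state) : C^o := (cstep RightMarker st).2.

Lemma caccept_form_linear : linear caccept_form.
Proof. by move=> a u v; rewrite /caccept_form linearP. Qed.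

HB.instance Definition _ :=
  GRing.isLinear.Build C state C^o *:%R caccept_form caccept_form_linear.

Definition caccept_prob (x : seq Sigma) : C :=
  caccept_form (run (fun s => linfun (cstep (Letter s)))
    (cstep LeftMarker (init M, 0)) x).

(** Positivity of [rho] survives every step, so each accumulated trace is real and [Re] loses
    nothing. *)
Lemma foldl_cstep (xs : seq (tape_symbol Sigma)) (rho : 'M[C]_n) (p q : R) :
  psd rho ->
  (foldl (step M) (rho, p, q) xs).1.2%:C
  = (foldl (fun st s => cstep s st) (rho, p%:C) xs).2.
Proof.
elim: xs rho p q => //= s xs IHxs rho p q rho_psd.
have E_psd := quantum_operation_psd (op_tp M s) rho_psd.
rewrite IHxs; last first.
  by rewrite -{2}[orthoproj (Hnon M)]orthoproj_adj; apply: psd_conj.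
by rewrite /cstep /= rmorphD /= RRe_real // ger0_real // psd_tr_orthoproj.
Qed.

Lemma caccept_probE (x : seq Sigma) : caccept_prob x = (accept_prob M x)%:C.
Proof.
have -> : accept_prob M x = (final_state M x).1.2.
  by rewrite /accept_prob; case: (final_state M x) => [[]].
have [init_psd _] := init_density M.
rewrite /final_state foldl_cstep // /tape /= foldl_rcons.
rewrite /caccept_prob /caccept_form; congr (cstep _ _).2.
elim: x (cstep _ _) => //= s x IHx st.
by rewrite /run /= lfunE; apply: IHx.
Qed.

End ComplexRun.

Theorem theorem18 (R : realType) (Sigma : finType) (n1 n2 : nat)
    (M1 : mm1gqfa R Sigma n1) (M2 : mm1gqfa R Sigma n2) :
  equivalent M1 M2 <-> k_equivalent M1 M2 ((n1 + n2) ^ 2)%N.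
Proof.
split=> [eqM w _|eq_short w]; first exact: eqM.
have n1_gt0 := density_dim_gt0 (init_density M1).
have n2_gt0 := density_dim_gt0 (init_density M2).
apply: (@complexI R); rewrite -!caccept_probE.
pose T n (M : mm1gqfa R Sigma n) s := linfun (cstep M (Letter s)).
apply: (@linear_automata_equiv _ _ _ _ (T _ M1) (T _ M2) _ _
  (caccept_form M1) (caccept_form M2)) => {}w lt_w.
change (caccept_prob M1 w = caccept_prob M2 w).
rewrite !caccept_probE eq_short //.
(* After cancellation this is [1 <= 2 * (n1 * n2)], hence the need for nonzero dimensions. The
   successor accounts for [lt_w] being strict. *)
have dim_le : (n1 * n1 + 1 + (n2 * n2 + 1) <= ((n1 + n2) ^ 2).+1)%N.
  rewrite sqrnD -!mulnn addnACA -[X in (_ <= X)%N]addn1 addnA.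
  by rewrite !leq_add2r leq_add2l !muln_gt0 n1_gt0.
exact: leq_trans lt_w dim_le.
Qed.
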